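(* Let $n,m,k$ be positive integers, let $X\in\mathbb{R}^{n\times n}$ be symmetric, let $\Lambda:\mathbb{R}^{n\times n}\to\mathbb{R}^{m\times m}$ be a linear map and $Y\in\mathbb{R}^{m\times m}$. Consider \[ (\mathrm{P})\qquad \max_{\rho\in\mathbb{R}^{n\times n}}\ \operatorname{Tr}(X\rho)\quad\text{s.t.}\quad \Lambda(\rho)=Y,\ \operatorname{Tr}(\rho)=1,\ \rho\ge 0,\ \operatorname{rank}(\rho)\le k . \] Let $\mathcal{H}_A=\mathcal{H}_B=\mathbb{R}^n\otimes\mathbb{R}^k$ (so operators on $\mathcal{H}_A\otimes\mathcal{H}_B$ are $(nk)^2\times(nk)^2$ matrices), $\widetilde{X}=X\otimes\mathbb{1}_k$ and $\widetilde{\Lambda}(\cdot)=\Lambda[\operatorname{Tr}_2(\cdot)]$ with $\operatorname{Tr}_2$ the partial trace over the factor $\mathbb{R}^k$. Then (P) is equivalent to (has the same optimal value as) the conic program over real matrices $\Phi_{AB}$ \[ \max_{\Phi_{AB}}\ \operatorname{Tr}\big[(\widetilde{X}_A\otimes\mathbb{1}_B)\Phi_{AB}\big]\quad\text{s.t.}\quad \Phi_{AB}\in\mathrm{SEP},\ \operatorname{Tr}(\Phi_{AB})=1,\ V_{AB}\Phi_{AB}=\Phi_{AB},\ \Phi_{AB}^{T_A}=\Phi_{AB}, \] \[ (\widetilde{\Lambda}_A\otimes\mathrm{id}_B)(\Phi_{AB})=Y\otimes\operatorname{Tr}_A(\Phi_{AB}). \]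
   Context: $\mathrm{SEP}$ is the complex separable cone: the convex hull of $\{M_A\otimes N_B: M_A\ge0,N_B\ge0\}$ with $M_A,N_B$ complex positive semidefinite $nk\times nk$ matrices; the constraint requires the real matrix $\Phi_{AB}$ to lie in this cone. $V_{AB}$ is the swap of the two tensor factors. $\Phi_{AB}^{T_A}$ denotes the partial transpose on the first factor $\mathcal{H}_A$ with respect to the standard basis. A subscript $A$ (resp. $B$) indicates action on the first (resp. second) factor, $\mathrm{id}_B$ is the identity map, $\operatorname{Tr}_A$ the partial trace over the first factor. *)

(* Defs.v *)
From HB Require Import structures.
From mathcomp Require Import all_boot all_order all_algebra.
From mathcomp Require Import complex mxtens.
From mathcomp Require Import boolp classical_sets reals constructive_ereal ereal.

Set Implicit Arguments.
Unset Strict Implicit.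
Unset Printing Implicit Defensive.

Import Order.TTheory GRing.Theory Num.Theory.
Local Open Scope ring_scope.

(* Conventions: a tensor product space C^d (x) C^e is indexed by 'I_(d*e),
   with (a,b) |-> mxtens_index (a,b) = a*e + b (first factor = high digit),
   which is exactly the Kronecker convention of [tensmx] (A *t B). *)

Section Ops.
Variable K : pzRingType.

Definition ptrace2 {d e : nat} (M : 'M[K]_(d * e)) : 'M[K]_d :=
  \matrix_(i, j) \sum_(a < e) M (mxtens_index (i, a)) (mxtens_index (j, a)).

Definition ptrace1 {d e : nat} (M : 'M[K]_(d * e)) : 'M[K]_e :=
  \matrix_(b, b') \sum_(a < d) M (mxtens_index (a, b)) (mxtens_index (a, b')).

Definition swapmx (d : nat) : 'M[K]_(d * d) :=
  \matrix_(i, j)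
    (((mxtens_unindex i).1 == (mxtens_unindex j).2) &&
     ((mxtens_unindex i).2 == (mxtens_unindex j).1))%:R.

Definition ptransA {d e : nat} (M : 'M[K]_(d * e)) : 'M[K]_(d * e) :=
  \matrix_(i, j)
    M (mxtens_index ((mxtens_unindex j).1, (mxtens_unindex i).2))
      (mxtens_index ((mxtens_unindex i).1, (mxtens_unindex j).2)).

Definition blockB {d e : nat} (M : 'M[K]_(d * e)) (b b' : 'I_e) : 'M[K]_d :=
  \matrix_(a, a') M (mxtens_index (a, b)) (mxtens_index (a', b')).

(* (L (x) id) applied to M, for a map L : 'M_d -> 'M_d' :
   (L (x) id)(sum_{b,b'} M_{bb'} (x) E_{bb'}) = sum_{b,b'} L(M_{bb'}) (x) E_{bb'} *)
Definition mapA {d d' e : nat} (L : 'M[K]_d -> 'M[K]_d') (M : 'M[K]_(d * e))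
  : 'M[K]_(d' * e) :=
  \matrix_(i, j)
    L (blockB M (mxtens_unindex i).2 (mxtens_unindex j).2)
      (mxtens_unindex i).1 (mxtens_unindex j).1.

End Ops.

Definition psd_real {R : numDomainType} {d : nat} (A : 'M[R]_d) : Prop :=
  A^T = A /\ forall x : 'cV[R]_d, 0 <= (x^T *m A *m x) 0 0.

Definition psd_cplx {C : numClosedFieldType} {d : nat} (A : 'M[C]_d) : Prop :=
  (map_mx Num.conj A)^T = A /\
  forall x : 'cV[C]_d, 0 <= ((map_mx Num.conj x)^T *m A *m x) 0 0.

Definition SEP {C : numClosedFieldType} {d : nat} (Phi : 'M[C]_(d * d)) : Prop :=
  exists (r : nat) (lam : 'I_r -> C) (M N : 'I_r -> 'M[C]_d),
    (forall i, 0 <= lam i) /\ \sum_(i < r) lam i = 1 /\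
    (forall i, psd_cplx (M i)) /\ (forall i, psd_cplx (N i)) /\
    Phi = \sum_(i < r) lam i *: (M i *t N i).

Definition cplxmx {R : rcfType} {p q : nat} (A : 'M[R]_(p, q)) : 'M[R[i]]_(p, q) :=
  map_mx (fun x : R => x%:C%C) A.

Definition feasP {R : rcfType} {n m : nat} (k : nat)
  (Lam : 'M[R]_n -> 'M[R]_m) (Y : 'M[R]_m) : set 'M[R]_n :=
  [set rho | Lam rho = Y /\ \tr rho = 1 /\ psd_real rho /\ (\rank rho <= k)%N].
Arguments feasP {R n m} k Lam Y _.

Definition objP {R : rcfType} {n : nat} (X rho : 'M[R]_n) : R := \tr (X *m rho).

Definition Lamt {R : rcfType} {n m : nat} (k : nat)
  (Lam : 'M[R]_n -> 'M[R]_m) (M : 'M[R]_(n * k)) : 'M[R]_m :=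
  Lam (ptrace2 M).
Arguments Lamt {R n m} k Lam M.

Definition Xt {R : rcfType} {n : nat} (k : nat) (X : 'M[R]_n) : 'M[R]_(n * k) :=
  X *t (1%:M : 'M[R]_k).
Arguments Xt {R n} k X.

Definition feasSEP {R : rcfType} {n m : nat} (k : nat)
  (Lam : 'M[R]_n -> 'M[R]_m) (Y : 'M[R]_m) : set 'M[R]_((n * k) * (n * k)) :=
  [set Phi | SEP (cplxmx Phi) /\ \tr Phi = 1 /\
             swapmx _ (n * k) *m Phi = Phi /\ ptransA Phi = Phi /\
             mapA (Lamt k Lam) Phi = Y *t ptrace1 Phi].
Arguments feasSEP {R n m} k Lam Y _.

Definition objSEP {R : rcfType} {n : nat} (k : nat) (X : 'M[R]_n)
  (Phi : 'M[R]_((n * k) * (n * k))) : R :=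
  \tr ((Xt k X *t (1%:M : 'M[R]_(n * k))) *m Phi).
Arguments objSEP {R n} k X Phi.

(* Main.v *)
Require Import Defs.
From HB Require Import structures.
From mathcomp Require Import all_boot all_order all_algebra.
From mathcomp Require Import complex mxtens ring.
From mathcomp Require Import boolp classical_sets reals constructive_ereal ereal.

(** If [rho = B B^T] with [B] of size n x k and [w = vec B], then
    [rho = Tr_2 (w w^T)] and [(w w^T) (x) (w w^T)] is feasible for the conic
    program with the same value.

    Conversely a separable [Phi] is a sum of projectors on product vectors
    [x (x) y].  Swap invariance forces every antisymmetric part [x (x) y - y (x) x]
    to vanish, and together with invariance under partial transposition the same
    holds for [conj x (x) y]; hence each term is [psi (x) psi] with
    [psi = w w^T] and [w] real.  Evaluating each component of
    [Lam o Tr_2 - Y Tr] on both factors gives a vanishing sum of squares, so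
    every normalized [Tr_2 psi] is feasible for (P), and the conic objective is
    an average of their values. *)

Import Order.TTheory GRing.Theory Num.Theory.
Local Open Scope ring_scope.
Local Open Scope classical_set_scope.

(** * Factorization of positive semidefinite matrices *)

Section PsdFactorization.
Variables (K : numFieldType) (cj : {rmorphism K -> K}).
Hypothesis cjK : involutive cj.
Hypothesis mul_cj : forall x : K, x * cj x = `|x| ^+ 2.
Hypothesis cj_sqrt : forall x : K, 0 <= x -> exists y, y * cj y = x.

Local Notation adj A := (map_mx cj A)^T.

Lemma adjK p q (A : 'M[K]_(p, q)) : adj (adj A) = A.
Proof. by apply/matrixP=> i j; rewrite !mxE cjK. Qed.

Lemma adjM p q r (A : 'M[K]_(p, q)) (B : 'M[K]_(q, r)) :
  adj (A *m B) = adj B *m adj A.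
Proof. by rewrite map_mxM trmx_mul. Qed.

Lemma adjB p q (A B : 'M[K]_(p, q)) : adj (A - B) = adj A - adj B.
Proof. by rewrite map_mxB linearB. Qed.

Lemma adjZ p q c (A : 'M[K]_(p, q)) : adj (c *: A) = cj c *: adj A.
Proof. by rewrite map_mxZ linearZ. Qed.

(** With [cj] the identity this is [psd_real], with [cj] complex conjugation it is [psd_cplx]; one
    Cholesky argument serves both. *)
Definition psd_adj d (A : 'M[K]_d) : Prop :=
  adj A = A /\ forall x : 'cV[K]_d, 0 <= (adj x *m A *m x) 0 0.

Lemma psd_adj_conjugate d e (P : 'M[K]_(d, e)) (A : 'M[K]_d) :
  psd_adj _ A -> psd_adj _ (adj P *m A *m P).
Proof.
move=> [hA pA]; split; first by rewrite !adjM adjK hA mulmxA.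
by move=> x; have := pA (P *m x); rewrite adjM !mulmxA.
Qed.

Lemma adj_delta d (a : 'I_d) : adj (delta_mx a (0 : 'I_1)) = delta_mx 0 a.
Proof. by rewrite map_delta_mx trmx_delta. Qed.

Lemma sandwich_delta d (A : 'M[K]_d) (a b : 'I_d) :
  (delta_mx (0 : 'I_1) a *m A *m delta_mx b (0 : 'I_1)) = (A a b)%:M.
Proof.
rewrite -rowE -colE; apply/matrixP => i j.
by rewrite !ord1 !mxE eqxx mulr1n.
Qed.

(** When the diagonal vanishes, the form takes the value [-2 |A_ab|^2] at [e_b - A_ab e_a], and this
    has to be nonnegative. *)
Lemma psd_adj_diag0 d (A : 'M[K]_d) :
  psd_adj _ A -> (forall a, A a a = 0) -> A = 0.
Proof.
move=> [hA pA] dA; apply/matrixP => a b; rewrite mxE.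
have hba : A b a = cj (A a b) by rewrite -{1}hA !mxE.
have := pA (delta_mx b 0 - A a b *: delta_mx a 0).
rewrite adjB adjZ !adj_delta !(mulmxBl, mulmxBr) -!(scalemxAl, scalemxAr).
rewrite !sandwich_delta !dA hba !mxE !eqxx !mulr1n !mulr0 subr0 sub0r.
rewrite [cj _ * _]mulrC mul_cj -opprD oppr_ge0 -mulr2n pmulrn_lle0 // => le0.
have /eqP : `|A a b| ^+ 2 = 0 by apply/le_anti; rewrite le0 exprn_ge0.
by rewrite expf_eq0 /= normr_eq0 => /eqP.
Qed.

(* One Cholesky step: clearing row and column [a] of [A] is the congruence by
   [1 - e_a e_a^* A / A_aa], so it keeps positivity and lowers the rank. *)
Lemma psd_adj_pivot d (A : 'M[K]_d) (a : 'I_d) :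
  psd_adj _ A -> A a a != 0 ->
  exists (A' : 'M[K]_d) (u : 'cV[K]_d),
    [/\ psd_adj _ A', (\rank A' < \rank A)%N & A = u *m adj u + A'].
Proof.
move=> pA nz; have [hA qA] := pA.
pose e : 'cV[K]_d := delta_mx a 0; pose f := delta_mx (0 : 'I_1) a : 'rV[K]_d.
have hf : adj e = f by exact: adj_delta.
have faf : f *m A *m e = (A a a)%:M by exact: sandwich_delta.
have ha : cj (A a a) = A a a by rewrite -{2}hA !mxE.
have a_ge0 : 0 <= A a a by have := qA e; rewrite hf faf mxE eqxx.
have [y hy] := cj_sqrt _ a_ge0.
pose P := 1%:M - (A a a)^-1 *: (e *m (f *m A)).
have hAP : A *m P = A - (A a a)^-1 *: (A *m e *m (f *m A)).
  by rewrite mulmxBr mulmx1 -scalemxAr !mulmxA.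
have hP : adj P = 1%:M - (A a a)^-1 *: (A *m e *m f).
  by rewrite adjB adjZ fmorphV /= ha map_scalar_mx rmorph1 tr_scalar_mx !adjM hA hf
     -[in adj f]hf adjK.
have hPA : adj P *m A = A *m P.
  by rewrite hP hAP mulmxBl mul1mx -scalemxAl !mulmxA.
have Pe : P *m e = 0.
  rewrite mulmxBl mul1mx -scalemxAl -mulmxA faf mul_mx_scalar scalerA mulVf //.
  by rewrite scale1r subrr.
have PAP : adj P *m A *m P = A *m P.
  rewrite hPA -mulmxA {2}/P mulmxBr mulmx1 -scalemxAr [P *m (e *m _)]mulmxA Pe.
  by rewrite mul0mx scaler0 subr0.
(* Since [y * cj y = A a a], this [u] satisfies [u u^* = A e e^* A / A a a], the part of [A] removed
   by [P]. *)
exists (adj P *m A *m P), ((cj y)^-1 *: (A *m e)); split.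
- exact: psd_adj_conjugate.
(* The row space of [A *m P = adj P *m A] lies in that of [A]; if they agreed, [P *m e = 0] would
   give [A *m e = 0], against [A a a != 0]. *)
- apply: rank_ltmx; rewrite /ltmx PAP -{1}hPA submxMl /=.
  apply/negP => /submxP [D hD]; move: nz; rewrite -[A a a]mulr1n.
  have -> : A a a *+ 1 = (f *m A *m e) 0 0 by rewrite faf mxE eqxx.
  by rewrite -mulmxA {1}hD -!mulmxA Pe !mulmx0 mxE eqxx.
- rewrite PAP hAP adjZ adjM hA hf fmorphV /= cjK -scalemxAl -scalemxAr scalerA.
  by rewrite -invfM mulrC hy addrC subrK.
Qed.

(** Each pivot splits off one column and lowers the rank, so [k] columns suffice for rank at most
    [k]; zero columns fill the rest. The column count turns the rank bound of (P) into the factor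
    R^k. *)
Lemma psd_adj_factor d k (A : 'M[K]_d) :
  psd_adj _ A -> (\rank A <= k)%N -> exists B : 'M[K]_(d, k), A = B *m adj B.
Proof.
elim: k A => [|k IH] A pA rA.
  by exists 0; rewrite mul0mx; apply/eqP; rewrite -mxrank_eq0 -leqn0.
have [/existsP [a nz] | /existsPn z] := boolP [exists a, A a a != 0]; last first.
  exists 0; rewrite mul0mx; apply: psd_adj_diag0 => // a.
  by have := z a; rewrite negbK => /eqP.
have [A' [u [pA' lt eqA]]] := psd_adj_pivot _ A a pA nz.
have [B hB] := IH A' pA' (leq_trans lt rA).
suff h : A = row_mx u B *m adj (row_mx u B) by exists (row_mx u B).
by rewrite map_row_mx tr_row_mx mul_row_col -hB.
Qed.

End PsdFactorization.

Lemma psd_real_factor (R : rcfType) d k (A : 'M[R]_d) :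
  psd_real A -> (\rank A <= k)%N -> exists B : 'M[R]_(d, k), A = B *m B^T.
Proof.
move=> [hA pA] rA.
have [B hB] : exists B : 'M[R]_(d, k), A = B *m (map_mx idfun B)^T.
  apply: (@psd_adj_factor R idfun) => //.
  - by move=> x /=; rewrite real_normK ?num_real.
  - by move=> x x0; exists (Num.sqrt x); rewrite /= -expr2 sqr_sqrtr.
  - by split=> [|x]; rewrite map_mx_id.
by exists B; rewrite {1}hB map_mx_id.
Qed.

Lemma psd_cplx_factor (C : numClosedFieldType) d (A : 'M[C]_d) :
  psd_cplx A -> exists B : 'M[C]_d, A = B *m (map_mx Num.conj B)^T.
Proof.
move=> pA; apply: (@psd_adj_factor C Num.conj).
- exact: conjCK.
- by move=> x; rewrite normCK.
- move=> x x0; exists (sqrtC x).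
  by rewrite /= geC0_conj ?sqrtC_ge0 // -expr2 sqrtCK.
- exact: pA.
- exact: rank_leq_row.
Qed.

(** * Entrywise calculus of tensor products and partial traces *)

Lemma sum_mxtens (V : nmodType) d e (F : 'I_(d * e) -> V) :
  \sum_i F i = \sum_(a < d) \sum_(b < e) F (mxtens_index (a, b)).
Proof.
rewrite pair_bigA /= (reindex (@mxtens_index d e)) /=; last first.
  exists (@mxtens_unindex d e) => p _; first exact: mxtens_indexK.
  exact: mxtens_unindexK.
by apply: eq_bigr => -[a b].
Qed.

Lemma matrix_mxtensP (T : Type) d e d' e' (A B : 'M[T]_(d * e, d' * e')) :
  (forall a b a' b', A (mxtens_index (a, b)) (mxtens_index (a', b')) =
                     B (mxtens_index (a, b)) (mxtens_index (a', b'))) -> A = B.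
Proof.
move=> AB; apply/matrixP => i j.
by case: (mxtens_indexP i); case: (mxtens_indexP j).
Qed.

Section TensorOps.
Variable K : comPzRingType.

Lemma mxtrace_tens d e (A : 'M[K]_d) (B : 'M[K]_e) : \tr (A *t B) = \tr A * \tr B.
Proof.
rewrite /mxtrace sum_mxtens mulr_suml; apply: eq_bigr => a _.
by rewrite mulr_sumr; apply: eq_bigr => b _; rewrite tensmxE.
Qed.

Lemma ptrace1_tens d e (A : 'M[K]_d) (B : 'M[K]_e) : ptrace1 (A *t B) = \tr A *: B.
Proof.
apply/matrixP => b b'; rewrite !mxE mulr_suml.
by apply: eq_bigr => a _; rewrite tensmxE.
Qed.

Lemma ptrace1_sum d e (I : finType) (F : I -> 'M[K]_(d * e)) :
  ptrace1 (\sum_i F i) = \sum_i ptrace1 (F i).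
Proof.
apply/matrixP => b b'; rewrite summxE !mxE.
under [RHS]eq_bigr do rewrite mxE.
by rewrite exchange_big; apply: eq_bigr => a _; rewrite summxE.
Qed.

Lemma ptrace2_is_linear d e : linear (@ptrace2 K d e).
Proof.
move=> c A B; apply/matrixP => i j; rewrite !mxE mulr_sumr -big_split /=.
by apply: eq_bigr => a _; rewrite !mxE.
Qed.

HB.instance Definition _ d e :=
  GRing.isLinear.Build K 'M[K]_(d * e) 'M[K]_d *:%R (@ptrace2 K d e) (@ptrace2_is_linear d e).

Lemma mxtrace_ptrace2 d e (A : 'M[K]_(d * e)) : \tr (ptrace2 A) = \tr A.
Proof. by rewrite /mxtrace sum_mxtens; apply: eq_bigr => i _; rewrite mxE. Qed.

Lemma mxtrace_tens1_mul d e (X : 'M[K]_d) (A : 'M[K]_(d * e)) :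
  \tr ((X *t (1%:M : 'M_e)) *m A) = \tr (X *m ptrace2 A).
Proof.
rewrite /mxtrace sum_mxtens; apply: eq_bigr => i _.
rewrite mxE; under [RHS]eq_bigr do rewrite mxE mulr_sumr.
rewrite exchange_big; apply: eq_bigr => a _.
rewrite mxE sum_mxtens; apply: eq_bigr => j _.
rewrite (bigD1 a) //= big1 ?addr0 => [|b nba].
  by rewrite tensmxE !mxE eqxx mulr1.
by rewrite tensmxE !mxE eq_sym (negPf nba) mulr0 mul0r.
Qed.

Lemma swapmxE d p (A : 'M[K]_(d * d, p)) a b j :
  (swapmx K d *m A) (mxtens_index (a, b)) j = A (mxtens_index (b, a)) j.
Proof.
rewrite mxE (bigD1 (mxtens_index (b, a))) //= big1 => [|i ni].
  by rewrite mxE !mxtens_indexK /= !eqxx mul1r addr0.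
move: ni; case: (mxtens_indexP i) => b' a' ni.
rewrite mxE !mxtens_indexK /=.
case: andP => [[/eqP ea /eqP eb]|_]; last by rewrite mul0r.
by rewrite ea eb eqxx in ni.
Qed.

Lemma ptransAE d e (A : 'M[K]_(d * e)) a b a' b' :
  ptransA A (mxtens_index (a, b)) (mxtens_index (a', b')) =
  A (mxtens_index (a', b)) (mxtens_index (a, b')).
Proof. by rewrite mxE !mxtens_indexK. Qed.

Lemma mapAE d d' e (L : 'M[K]_d -> 'M[K]_d') (A : 'M[K]_(d * e)) s b t b' :
  mapA L A (mxtens_index (s, b)) (mxtens_index (t, b')) = L (blockB A b b') s t.
Proof. by rewrite mxE !mxtens_indexK. Qed.

Lemma blockB_tens d e (A : 'M[K]_d) (B : 'M[K]_e) b b' :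
  blockB (A *t B) b b' = B b b' *: A.
Proof. by apply/matrixP => a a'; rewrite !mxE !mxtens_indexK /= mulrC. Qed.

Lemma blockB_sum d e (I : finType) (F : I -> 'M[K]_(d * e)) b b' :
  blockB (\sum_i F i) b b' = \sum_i blockB (F i) b b'.
Proof.
apply/matrixP => a a'; rewrite summxE mxE summxE.
by apply: eq_bigr => i _; rewrite mxE.
Qed.

(** Here [w] is [W] flattened to a vector of the tensor product. Both directions of the equivalence
    pass between (P) and the conic program through this correspondence. *)
Lemma ptrace2_outer d e (w : 'cV[K]_(d * e)) (W : 'M[K]_(d, e)) :
  (forall i a, w (mxtens_index (i, a)) 0 = W i a) ->
  ptrace2 (w *m w^T) = W *m W^T.
Proof.
move=> wW; apply/matrixP => i j; rewrite !mxE; apply: eq_bigr => a _.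
by rewrite !mxE big_ord1 !mxE !wW.
Qed.

End TensorOps.

(** * Symmetric separable operators as sums of real tensor squares *)

(** Unless a vector vanishes, the first identity gives [y = c x] and the second then makes every
    [x b * conj (x o)] real, so [x] is a scalar times a real vector; its phase cancels in the
    product. *)
Lemma product_vector_real (R : rcfType) d (x y : 'I_d -> R[i]) :
  (forall a b, x a * y b = x b * y a) ->
  (forall a b, (x a)^* * y b = (x b)^* * y a) ->
  exists w : 'cV[R]_d, forall a b a' b',
    x a * (x a')^* * (y b * (y b')^*) = (w a 0 * w a' 0 * (w b 0 * w b' 0))%:C%C.
Proof.
move=> xy cxy.
have [/existsP [o xo] | /existsPn z] := boolP [exists a, x a != 0]; last first.
  exists 0 => a b a' b'; have := z a; rewrite negbK => /eqP ->.
  by rewrite !mxE !mul0r.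
have [co|co] := eqVneq (y o) 0.
  exists 0 => a b a' b'; rewrite !mxE !mul0r.
  have /eqP : x o * y b = 0 by rewrite xy co mulr0.
  by rewrite mulf_eq0 (negPf xo) /= => /eqP ->; rewrite mul0r mulr0.
pose c := y o / x o.
have yc b : y b = c * x b by rewrite /c mulrAC -[y o * _]mulrC -xy mulrC mulKf.
have c0 : c != 0 by rewrite mulf_neq0 ?invr_eq0.
have xs b : x b * (x o)^* = (x b)^* * x o.
  by apply: (mulfI c0); have := cxy o b; rewrite !yc => h; ring: h.
pose z b := complex.Re (x b * (x o)^*).
have zE b : (z b)%:C%C = x b * (x o)^*.
  by apply: RRe_real; apply/CrealP; rewrite rmorphM /= conjCK xs.
have no : `|x o| != 0 by rewrite normr_eq0.
(* Four factors [sqrt s * z] bring [s ^ 2 * |x o| ^ 4], while the target carries [|c| ^ 2]; this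
   fixes [s]. *)
pose q : R[i] := `|c| / `|x o| ^+ 2.
have q0 : 0 <= q by rewrite divr_ge0 ?exprn_ge0.
pose s := complex.Re q.
have sE : s%:C%C = q by apply: RRe_real; exact: ger0_real.
have s0 : 0 <= s by rewrite -ler0c sE.
exists (\col_b (Num.sqrt s * z b)) => a b a' b'; rewrite !mxE.
have -> : Num.sqrt s * z a * (Num.sqrt s * z a') * (Num.sqrt s * z b * (Num.sqrt s * z b'))
   = s ^+ 2 * (z a * z a' * (z b * z b')).
  by rewrite -{5}(sqr_sqrtr s0); ring.
have zz e e' : (z e)%:C%C * (z e')%:C%C = `|x o| ^+ 2 * (x e * (x e')^*).
  by rewrite !zE normCK; ring: (xs e').
rewrite !rmorphM /= sE !zz !yc rmorphM /=.
have -> : c * x b * (c^* * (x b')^*) = `|c| ^+ 2 * (x b * (x b')^*).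
  by rewrite normCK; ring.
by rewrite /q; field.
Qed.

(* A positive combination of product vectors that is invariant under the swap
   and under partial transposition: the squared norms of the antisymmetric parts
   of [x j (x) y j] and of [conj (x j) (x) y j] both sum to zero. *)
Lemma swap_ptrans_invariant (C : numClosedFieldType) (I : finType) d
    (x y : I -> 'I_d -> C) (F : 'I_d -> 'I_d -> 'I_d -> 'I_d -> C) :
  (forall a b a' b', F a b a' b' =
     \sum_j x j a * (x j a')^* * (y j b * (y j b')^*)) ->
  (forall a b a' b', F a b a' b' = F b a a' b') ->
  (forall a b a' b', F a b a' b' = F a' b a b') ->
  forall j, (forall a b, x j a * y j b = x j b * y j a) /\
            (forall a b, (x j a)^* * y j b = (x j b)^* * y j a).
Proof.
move=> FE Fs Ft.
have vanish (f : I -> C) : \sum_i `|f i| ^+ 2 = 0 -> forall i, f i = 0.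
  move=> /psumr_eq0P h i; apply/eqP; rewrite -normr_eq0 -sqrf_eq0; apply/eqP.
  by apply: h => // l _; exact: exprn_ge0.
move=> j; split=> a b; apply/eqP; rewrite -subr_eq0; apply/eqP.
  apply: (vanish (fun j => x j a * y j b - x j b * y j a)).
  transitivity (F a b a b - F a b b a - F b a a b + F b a b a).
    rewrite !FE -!sumrB -big_split /=; apply: eq_bigr => i _.
    by rewrite normCK rmorphB !rmorphM /=; ring.
  by rewrite (Fs b a a b) (Fs b a b a); ring.
apply: (vanish (fun j => (x j a)^* * y j b - (x j b)^* * y j a)).
(* Conjugating [x] exchanges its two indices in the cross terms; partial transposition undoes this,
   and the swap then cancels the sum. *)
transitivity (F a b a b - F b b a a - F a a b b + F b a b a).
  rewrite !FE -!sumrB -big_split /=; apply: eq_bigr => i _.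
  by rewrite normCK rmorphB !rmorphM /= !conjCK; ring.
by rewrite (Ft b b a a) (Ft a a b b) (Fs a b b a) (Fs b a a b); ring.
Qed.

(** Factorizing each [M i] and [N i] expands their tensor product over pairs of columns; the weight
    [lam i] enters the first vector through its square root. *)
Lemma SEP_product_vectors (C : numClosedFieldType) d (Phi : 'M[C]_(d * d)) :
  SEP Phi -> exists (I : finType) (x y : I -> 'I_d -> C), forall a b a' b',
    Phi (mxtens_index (a, b)) (mxtens_index (a', b')) =
    \sum_j x j a * (x j a')^* * (y j b * (y j b')^*).
Proof.
move=> [r [lam [M [N [lam0 [_ [pM [pN ->]]]]]]]].
have [B hB] := choice (fun i => psd_cplx_factor _ _ _ (pM i)).
have [D hD] := choice (fun i => psd_cplx_factor _ _ _ (pN i)).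
exists ('I_r * ('I_d * 'I_d))%type.
exists (fun j a => sqrtC (lam j.1) * B j.1 a j.2.1), (fun j b => D j.1 b j.2.2).
move=> a b a' b'; rewrite summxE.
rewrite -(pair_bigA _ (fun i pq => sqrtC (lam i) * B i a pq.1 *
  (sqrtC (lam i) * B i a' pq.1)^* * (D i b pq.2 * (D i b' pq.2)^*))) /=.
apply: eq_bigr => i _; rewrite mxE tensmxE.
have lamE : lam i = sqrtC (lam i) * (sqrtC (lam i))^*.
  by rewrite /= geC0_conj ?sqrtC_ge0 // -expr2 sqrtCK.
rewrite -(pair_bigA _ (fun p q => sqrtC (lam i) * B i a p *
  (sqrtC (lam i) * B i a' p)^* * (D i b q * (D i b' q)^*))) /=.
rewrite {1}hB {1}hD !mxE mulr_suml mulr_sumr; apply: eq_bigr => p _.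
rewrite mulr_sumr mulr_sumr; apply: eq_bigr => q _.
by rewrite !mxE {1}lamE rmorphM /=; ring.
Qed.

Lemma SEP_swap_ptrans_real (R : rcfType) d (Phi : 'M[R]_(d * d)) :
  SEP (cplxmx Phi) -> swapmx _ d *m Phi = Phi -> ptransA Phi = Phi ->
  exists (I : finType) (w : I -> 'cV[R]_d),
    Phi = \sum_j (w j *m (w j)^T) *t (w j *m (w j)^T).
Proof.
move=> /SEP_product_vectors [I [x [y PhiE]]] hs ht.
have hsw a b a' b' : cplxmx Phi (mxtens_index (a, b)) (mxtens_index (a', b')) =
    cplxmx Phi (mxtens_index (b, a)) (mxtens_index (a', b')).
  by rewrite !mxE -{1}hs swapmxE.
have hpt a b a' b' : cplxmx Phi (mxtens_index (a, b)) (mxtens_index (a', b')) =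
    cplxmx Phi (mxtens_index (a', b)) (mxtens_index (a, b')).
  by rewrite !mxE -{1}ht ptransAE.
(* Invariance of the sum passes to each product vector separately, so a real [w j] can be chosen
   term by term. *)
have inv := swap_ptrans_invariant _ _ _ x y _ PhiE hsw hpt.
have [w hw] := choice (fun j => let: conj h1 h2 := inv j in
  product_vector_real _ _ _ _ h1 h2).
exists I, w; apply: matrix_mxtensP => a b a' b'; apply: (@complexI R).
have := PhiE a b a' b'; rewrite mxE => ->.
rewrite summxE raddf_sum; apply: eq_bigr => j _.
by rewrite hw tensmxE !mxE !big_ord1 !mxE.
Qed.

(** * Feasible points of each program from those of the other *)

Section Outer.
Variable R : rcfType.

Lemma psd_real_mulmx_tr d e (W : 'M[R]_(d, e)) : psd_real (W *m W^T).
Proof.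
split=> [|x]; first by rewrite trmx_mul trmxK.
have -> : x^T *m (W *m W^T) *m x = (W^T *m x)^T *m (W^T *m x).
  by rewrite trmx_mul trmxK !mulmxA.
by rewrite mxE sumr_ge0 // => i _; rewrite mxE -expr2 sqr_ge0.
Qed.

Lemma psd_realZ d (c : R) (A : 'M[R]_d) : 0 <= c -> psd_real A -> psd_real (c *: A).
Proof.
move=> c0 [hA pA]; split=> [|x]; first by rewrite linearZ /= hA.
by rewrite -scalemxAr -scalemxAl mxE mulr_ge0.
Qed.

Lemma psd_cplx_outer d (w : 'cV[R]_d) : psd_cplx (cplxmx (w *m w^T)).
Proof.
have cw : map_mx Num.conj (cplxmx w) = cplxmx w.
  apply/matrixP => i j; rewrite !mxE; apply/CrealP.
  by rewrite complex_real.
have -> : cplxmx (w *m w^T) = cplxmx w *m (cplxmx w)^T.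
  by rewrite /cplxmx map_mxM map_trmx.
split=> [|x]; first by rewrite map_mxM trmx_mul map_trmx trmxK cw.
have -> : (map_mx Num.conj x)^T *m (cplxmx w *m (cplxmx w)^T) *m x =
    (map_mx Num.conj ((cplxmx w)^T *m x))^T *m ((cplxmx w)^T *m x).
  by rewrite map_mxM trmx_mul -map_trmx trmxK cw !mulmxA.
by rewrite mxE big_ord1 !mxE mulrC mul_conjC_ge0.
Qed.

(** Reshaping [w] as an [n x k] matrix [W] gives [Tr_2 (w w^T) = W W^T], which is positive
    semidefinite of rank at most [k]; dividing by [t] normalizes the trace. *)
Lemma feasP_ptrace2 n m k (Lam : {linear 'M[R]_n -> 'M[R]_m}) (Y : 'M[R]_m)
    (w : 'cV[R]_(n * k)) (t := \tr (w *m w^T)) :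
  t != 0 -> Lam (ptrace2 (w *m w^T)) = t *: Y ->
  feasP k Lam Y (t^-1 *: ptrace2 (w *m w^T)).
Proof.
move=> t0 LE.
pose W : 'M[R]_(n, k) := \matrix_(i, a) w (mxtens_index (i, a)) 0.
have WE : ptrace2 (w *m w^T) = W *m W^T by apply: ptrace2_outer => i a; rewrite mxE.
split; first by rewrite linearZ /= LE scalerA mulVf // scale1r.
split; first by rewrite linearZ /= mxtrace_ptrace2 mulVf.
split.
  rewrite WE; apply: psd_realZ; last exact: psd_real_mulmx_tr.
  rewrite invr_ge0 /t mxtrace_mulC /mxtrace big_ord1.
  by rewrite mxE sumr_ge0 // => i _; rewrite mxE -expr2 sqr_ge0.
rewrite WE; apply: leq_trans (mxrank_scale _ _) _.
exact: leq_trans (mxrankM_maxl _ _) (rank_leq_col _).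
Qed.

Lemma feasSEP_of_feasP n m k (X : 'M[R]_n) (Lam : {linear 'M[R]_n -> 'M[R]_m})
    (Y : 'M[R]_m) (rho : 'M[R]_n) :
  feasP k Lam Y rho ->
  exists2 Phi, feasSEP k Lam Y Phi & objSEP k X Phi = objP X rho.
Proof.
move=> [LE [tr1 [pR rR]]].
have [B rhoE] := psd_real_factor _ _ _ _ pR rR.
pose w : 'cV[R]_(n * k) :=
  \col_i B (mxtens_unindex i).1 (mxtens_unindex i).2.
have wE : ptrace2 (w *m w^T) = rho.
  by rewrite rhoE; apply: ptrace2_outer => i a; rewrite mxE mxtens_indexK.
have trw : \tr (w *m w^T) = 1 by rewrite -mxtrace_ptrace2 wE.
have ww a b : (w *m w^T) a b = w a 0 * w b 0.
  by rewrite mxE big_ord1 [w^T _ _]mxE.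
exists ((w *m w^T) *t (w *m w^T)); last first.
  by rewrite /objSEP tensmx_mul mul1mx mxtrace_tens trw mulr1 mxtrace_tens1_mul wE.
split.
  exists 1%N, (fun=> 1), (fun=> cplxmx (w *m w^T)), (fun=> cplxmx (w *m w^T)).
  split=> //; split; first by rewrite big_ord1.
  split=> [_|]; first exact: psd_cplx_outer.
  split=> [_|]; first exact: psd_cplx_outer.
  by rewrite big_ord1 scale1r; apply: map_mxT.
split; first by rewrite mxtrace_tens trw mulr1.
split.
  (* Each entry is a product of four entries of [w], which the swap, and below the partial
     transpose, only permute. *)
  by apply: matrix_mxtensP => a b a' b'; rewrite swapmxE !tensmxE !ww; ring.
split.
  by apply: matrix_mxtensP => a b a' b'; rewrite ptransAE !tensmxE !ww; ring.
apply: matrix_mxtensP => s b t b'.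
rewrite mapAE blockB_tens /Lamt linearZ /= linearZ /= wE LE ptrace1_tens trw.
by rewrite scale1r tensmxE mxE mulrC.
Qed.

(* Applying the functional [f = (Lam o Tr_2 - Y Tr)_st] on both factors turns
   the linear constraint into [\sum_j f (psi j) ^+ 2 = 0]. *)
Lemma mapA_outer_sum n m k (Lam : {linear 'M[R]_n -> 'M[R]_m}) (Y : 'M[R]_m)
    (I : finType) (psi : I -> 'M[R]_(n * k)) (Phi := \sum_j psi j *t psi j) :
  mapA (Lamt k Lam) Phi = Y *t ptrace1 Phi ->
  forall j, Lam (ptrace2 (psi j)) = \tr (psi j) *: Y.
Proof.
move=> hM j; apply/matrixP => s t; rewrite mxE [RHS]mulrC.
pose f (A : 'M[R]_(n * k)) := Lam (ptrace2 A) s t - Y s t * \tr A.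
(* Entry [(s, t)] of the constraint applies [f] to the first factor only and leaves a matrix
   identity on the second. *)
have sum0 : \sum_j f (psi j) *: psi j = 0.
  apply/matrixP => b b'.
  have := congr1 (fun A : 'M_(m * (n * k)) =>
    A (mxtens_index (s, b)) (mxtens_index (t, b'))) hM.
  rewrite mapAE tensmxE /Lamt blockB_sum ptrace1_sum !linear_sum !summxE => h.
  rewrite [RHS]mxE.
  transitivity (\sum_i (Lam (ptrace2 (blockB (psi i *t psi i) b b')) s t
    - Y s t * ptrace1 (psi i *t psi i) b b')).
    apply: eq_bigr => i _.
    by rewrite blockB_tens ptrace1_tens !linearZ /= !mxE mulrBl mulrC mulrA.
  by rewrite sumrB -mulr_sumr -h subrr.
(* Applying the linear [f] again, now on the second factor, produces the squares. *)
have fsum : f (\sum_j f (psi j) *: psi j) = \sum_j f (psi j) ^+ 2.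
  rewrite /f !linear_sum summxE mulr_sumr -sumrB; apply: eq_bigr => i _.
  by rewrite !linearZ /= mxE /f; ring.
have /psumr_eq0P h : \sum_j f (psi j) ^+ 2 = 0.
  by rewrite -fsum sum0 /f !linear0 mxE mulr0 subrr.
apply/eqP; rewrite -subr_eq0 -/(f _) -sqrf_eq0; apply/eqP.
by apply: h => // i _; exact: sqr_ge0.
Qed.

Lemma feasP_of_feasSEP n m k (X : 'M[R]_n) (Lam : {linear 'M[R]_n -> 'M[R]_m})
    (Y : 'M[R]_m) (Phi : 'M[R]_((n * k) * (n * k))) :
  feasSEP k Lam Y Phi ->
  exists2 rho, feasP k Lam Y rho & objSEP k X Phi <= objP X rho.
Proof.
move=> [sP [tr1 [hs [ht hL]]]].
have [I [w PhiE]] := SEP_swap_ptrans_real _ _ _ sP hs ht.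
pose psi j := w j *m (w j)^T; pose t j := \tr (psi j).
have hY j : Lam (ptrace2 (psi j)) = t j *: Y.
  by apply: (mapA_outer_sum _ _ _ _ _ I psi); rewrite -PhiE.
have objE : objSEP k X Phi = \sum_j \tr (X *m ptrace2 (psi j)) * t j.
  rewrite /objSEP PhiE mulmx_sumr linear_sum; apply: eq_bigr => j _.
  by rewrite /= tensmx_mul mul1mx mxtrace_tens mxtrace_tens1_mul.
have {}tr1 : \sum_j t j ^+ 2 = 1.
  rewrite -tr1 PhiE linear_sum; apply: eq_bigr => j _.
  by rewrite /= mxtrace_tens expr2.
pose rho j := (t j)^-1 *: ptrace2 (psi j).
(* The conic value is the average of the [objP X (rho j)] with weights [t j ^ 2]. If all feasible
   values were smaller, every weight would vanish, although the weights sum to one. *)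
apply: contrapT => none.
have lt j : t j != 0 -> objP X (rho j) < objSEP k X Phi.
  move=> t0; rewrite ltNge; apply/negP => le; apply: none.
  by exists (rho j) => //; exact: feasP_ptrace2 t0 (hY j).
have termE j : \tr (X *m ptrace2 (psi j)) * t j = t j ^+ 2 * objP X (rho j).
  (* If [t j = 0], then [rho j] is zero by the convention [0^-1 = 0], and the factor [t j] makes
     both sides vanish. *)
  have [t0|t0] := eqVneq (t j) 0; first by rewrite t0 expr0n mulr0 mul0r.
  by rewrite /objP /rho -scalemxAr linearZ /= mulrA expr2 mulfK // mulrC.
pose v := objSEP k X Phi.
have /psumr_eq0P h : \sum_j t j ^+ 2 * (v - objP X (rho j)) = 0.
  under eq_bigr do rewrite mulrBr.
  rewrite sumrB -mulr_suml tr1 mul1r /v objE.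
  by under eq_bigr do rewrite termE; rewrite subrr.
have t0 j : t j = 0.
  apply/eqP/negP => /negP tj; have vlt := lt j tj.
  have : t j ^+ 2 * (v - objP X (rho j)) = 0.
    apply: h => // i _.
    have [->|ti] := eqVneq (t i) 0; first by rewrite expr0n mul0r.
    by rewrite mulr_ge0 ?sqr_ge0 // subr_ge0 ltW // lt.
  by apply/eqP; rewrite mulf_neq0 ?expf_neq0 // gt_eqF // subr_gt0.
move: tr1; rewrite big1 => [/eqP|j _]; last by rewrite t0 expr0n.
by rewrite eq_sym oner_eq0.
Qed.

End Outer.

(** * Equality of the two optimal values *)

Theorem theorem3 (R : realType) (n m k : nat)
  (hn : (0 < n)%N) (hm : (0 < m)%N) (hk : (0 < k)%N)
  (X : 'M[R]_n) (hX : X^T = X)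
  (Lam : {linear 'M[R]_n -> 'M[R]_m}) (Y : 'M[R]_m) :
  ereal_sup [set (objP X rho)%:E | rho in feasP k Lam Y] =
  ereal_sup [set (objSEP k X Phi)%:E | Phi in feasSEP k Lam Y].
Proof.
(* Every feasible value of one program is bounded by a feasible value of the other; this also covers
   empty feasible sets, where both suprema are minus infinity. *)
apply/le_anti/andP; split; apply/ereal_supP => _ [A fA <-]; apply: le_ereal_sup_tmp.
  have [Phi fPhi obj] := feasSEP_of_feasP _ _ _ _ X _ _ _ fA.
  by exists (objSEP k X Phi)%:E; [exists Phi | rewrite obj].
have [rho frho obj] := feasP_of_feasSEP _ _ _ _ X _ _ _ fA.
by exists (objP X rho)%:E; [exists rho | rewrite lee_fin].
Qed.
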